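(* Every finite simple connected graph $\Gamma$ with maximum valency at least three has a subdivision $\Gamma'$ satisfying $\mathrm{pmd}(\Gamma')=\Delta(\Gamma')$.
   Context: $\Delta(\cdot)$ denotes maximum valency (degree). A subdivision of a graph $\Gamma$ is a graph obtained from $\Gamma$ by replacing edges of $\Gamma$ by (internally disjoint) paths of length at least one. A matching $M$ (a set of pairwise disjoint edges) of a graph $\Gamma=(V,E)$ is positive if there is $w\colon V\to\mathbb{R}$ with $w(u)+w(v)>0$ for every $uv\in M$ and $w(u)+w(v)<0$ for every $uv\in E\setminus M$. A positive matching decomposition (pmd) of $\Gamma$ is a partition $E=E_1\cup\cdots\cup E_p$ into pairwise disjoint subsets such that $E_i$ is a positive matching of $(V,E\setminus\bigcup_{j<i}E_j)$ for $i=1,\ldots,p$. $\mathrm{pmd}(\Gamma)$ denotes the smallest $p$ for which $\Gamma$ has a pmd with $p$ parts. *)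

(* Defs.v *)
From HB Require Import structures.
From mathcomp Require Import all_boot all_order all_algebra.
From mathcomp Require Import boolp reals.

Set Implicit Arguments.
Unset Strict Implicit.
Unset Printing Implicit Defensive.

Import Order.TTheory GRing.Theory Num.Theory.

Record sgraph : Type := SGraph {
  vertex :> finType;
  adj : rel vertex;
  adj_sym : symmetric adj;
  adj_irrefl : irreflexive adj }.

Definition connected (G : sgraph) : Prop :=
  forall x y : G, connect (@adj G) x y.

Definition valency (G : sgraph) (x : G) : nat := #|[set y : G | adj x y]|.

Definition max_valency (G : sgraph) : nat := \max_(x : G) valency x.

Definition edges (G : sgraph) : {set {set G}} :=
  [set [set x; y] | x in G, y in G & adj x y].

(* [branch] embeds the vertices of G into H, and [inner x y] lists, from x to  *)
(* y, the internal vertices of the path of H that replaces the edge xy; it is  *)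
(* empty when that path has length one.  Its values on non-edges are           *)
(* irrelevant.                                                                 *)
Record subdivision_by (G H : sgraph) (branch : G -> H)
    (inner : G -> G -> seq H) : Prop := SubdivisionBy {
  branch_inj : injective branch;
  inner_path : forall x y, adj x y ->
    path (@adj H) (branch x) (rcons (inner x y) (branch y));
  inner_uniq : forall x y, adj x y -> uniq (inner x y);
  inner_rev : forall x y, adj x y -> inner y x = rev (inner x y);
  inner_branch : forall x y z, adj x y -> branch z \notin inner x y;
  inner_disjoint : forall x y x' y' v, adj x y -> adj x' y' ->
    v \in inner x y -> v \in inner x' y' -> [set x; y] = [set x'; y'];
  vertex_cover : forall v : H,
    (exists x, v = branch x) \/ (exists x y, adj x y /\ v \in inner x y);
  edge_cover : forall u v : H, adj u v ->
    exists x y, adj x y /\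
      infix [:: u; v] (branch x :: rcons (inner x y) (branch y)) }.

Definition subdivision (G H : sgraph) : Prop :=
  exists (branch : G -> H) (inner : G -> G -> seq H),
    subdivision_by branch inner.

Section PositiveMatching.
Variables (R : realType) (G : sgraph).
Implicit Types F M : {set {set G}}.
Local Open Scope ring_scope.

(* M is a positive matching of the graph (V(G), F), for F a subset of the edge *)
(* set of G.                                                                   *)
Definition positive_matching F M : Prop :=
  [/\ M \subset F,
      trivIset M
    & exists w : G -> R, forall u v,
        ([set u; v] \in M -> 0 < w u + w v) /\
        ([set u; v] \in F :\: M -> w u + w v < 0)].

(* Empty parts are allowed; discarding them leaves a shorter decomposition, so *)
(* the minimum below is unaffected.                                            *)
Definition is_pmd (p : nat) (E_ : 'I_p -> {set {set G}}) : Prop :=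
  [/\ \bigcup_i E_ i = edges G,
      forall i j, i != j -> [disjoint E_ i & E_ j]
    & forall i : 'I_p,
        positive_matching (edges G :\: \bigcup_(j : 'I_p | (j < i)%N) E_ j) (E_ i)].

Definition has_pmd (p : nat) : Prop :=
  exists E_ : 'I_p -> {set {set G}}, is_pmd E_.

Lemma edgesP (e : {set G}) :
  e \in edges G -> exists x y, adj x y /\ e = [set x; y].
Proof. by case/imset2P=> x y _; rewrite inE => /andP[_ xy] ->; exists x, y. Qed.

Lemma card_edge (e : {set G}) : e \in edges G -> #|e| = 2.
Proof.
case/edgesP=> x [y [xy ->]]; rewrite cards2.
by case: eqVneq xy => // ->; rewrite adj_irrefl.
Qed.

Lemma positive_matching1 F e :
  F \subset edges G -> e \in F -> positive_matching F [set e].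
Proof.
move=> FE eF; split.
- by rewrite sub1set.
- by apply/trivIsetP => A B; rewrite !inE => /eqP-> /eqP->; rewrite eqxx.
exists (fun z => if z \in e then 1 else - 2) => u v; split.
  by rewrite inE => /eqP <-; rewrite !inE !eqxx orbT addr_gt0 ?ltr01.
rewrite !inE => /andP[uv_e uvF].
have lt12 : (1 < 2 :> R)%R by rewrite ltr1n.
case ue: (u \in e); case ve: (v \in e).
- case/negP: uv_e; rewrite eqEcard subUset !sub1set ue ve /=.
  by rewrite !card_edge ?(subsetP FE).
- by rewrite subr_lt0.
- by rewrite addrC subr_lt0.
by rewrite -opprD oppr_lt0 addr_gt0 ?ltr0n.
Qed.

Lemma has_pmd_exists : exists p, `[< has_pmd p >].
Proof.
exists #|edges G|; apply/asboolP.
exists (fun i => [set enum_val i]); split.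
- apply/setP => e; apply/bigcupP/idP => [[i _]|eE].
    by rewrite inE => /eqP->; exact: enum_valP.
  by exists (enum_rank_in eE e) => //; rewrite inE enum_rankK_in.
- move=> i j ij; rewrite disjoints1 inE; apply: contraNN ij.
  by move/eqP/enum_val_inj => ->.
move=> i; apply: positive_matching1; first exact: subsetDl.
rewrite inE enum_valP andbT; apply/bigcupP => -[j ji].
by rewrite inE => /eqP/enum_val_inj ij; rewrite ij ltnn in ji.
Qed.

Definition pmd : nat := ex_minn has_pmd_exists.

End PositiveMatching.

(* Main.v *)
Require Import Defs.
From mathcomp Require Import all_boot all_order all_algebra.
From mathcomp Require Import boolp reals.
From mathcomp Require Import lra.

(** The number of parts is at least the maximum valency of any graph, since a
    part is a matching and so contains at most one edge at each vertex
    ([max_valency_le_pmd]).  The content is therefore a subdivision [H] of [G]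
    with a decomposition into [max_valency G] parts.

    Replace every edge of [G] by a path of length seven, and view it as two
    legs of length three, one at each end, joined by a middle edge.  The legs
    at a vertex [x] form a spider centred at [x].  The first part consists of
    all middle edges together with one edge at each branch vertex.  Deleting
    it leaves a forest of pieces of spiders, whose valencies are smaller than
    [max_valency G]; here three colours are needed because inner vertices have
    valency two.  In a forest every matching is positive: walking away from a
    root, each new vertex can be given the weight that makes the sum along the
    new edge [1] or [-1], as desired.  So every proper edge colouring of the
    forest supplies the remaining parts.

    The first part is positive for the same weights, rooted at the branch
    vertices with the value [-2].  No leg edge but the one at the root can be
    in the first part, and a leg has odd length, so its last vertex has weight
    [2 + 1] or [2 - 1]; two such weights have a positive sum, as the middle
    edge requires.  The whole decomposition is encoded by a single edge
    colouring [colour], turned into parts by [has_pmd_of_colouring]. *)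

Set Implicit Arguments.
Unset Strict Implicit.
Unset Printing Implicit Defensive.

Import Order.TTheory GRing.Theory Num.Theory.

(** * Decompositions and edge colourings *)

Lemma set2_inj (T : finType) (a b c d : T) :
  [set a; b] = [set c; d] -> (a = c /\ b = d) \/ (a = d /\ b = c).
Proof.
move=> e.
have := set21 a b; rewrite e in_set2; have := set22 a b; rewrite e in_set2.
have := set21 c d; rewrite -e in_set2; have := set22 c d; rewrite -e in_set2.
by do 4![case/orP=> /eqP ?]; subst; auto.
Qed.

Lemma mem_edges (G : sgraph) (u v : G) : ([set u; v] \in edges G) = adj u v.
Proof.
apply/idP/idP => [/edgesP[x [y [xy]]]|uv]; last first.
  by apply/imset2P; exists u v; rewrite ?inE.
by case/set2_inj=> -[-> ->] //; rewrite adj_sym.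
Qed.

(** Each part holds at most one edge at [x], so sending a part to the other end
    of that edge covers all neighbours of [x]. *)
Lemma valency_le_pmd (R : realType) (G : sgraph) p (x : G) :
  has_pmd R G p -> valency x <= p.
Proof.
case=> E [cover _ pos].
pose g i := [pick y | [set x; y] \in E i].
have -> : valency x = #|Some @: [set y | adj x y]|.
  by rewrite card_imset //; exact: Some_inj.
rewrite -[p]card_ord -cardsT.
apply: (leq_trans _ (leq_imset_card g _)); apply: subset_leq_card.
apply/subsetP => _ /imsetP[y + ->]; rewrite inE -mem_edges -cover.
case/bigcupP=> i _ yE; apply/imsetP; exists i => //.
rewrite /g; case: pickP => [z zE|/(_ y)]; last by rewrite yE.
have [_ /trivIsetP triv _] := pos i.
apply: congr1; apply/eqP; apply: contraT => yz.
have [eyz|ne] := eqVneq [set x; y] [set x; z].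
  by case: (set2_inj eyz) yz => -[? ?]; subst; rewrite eqxx.
have /pred0P/(_ x) := triv _ _ yE zE ne.
by rewrite /= !inE eqxx.
Qed.

Lemma max_valency_le_pmd (R : realType) (G : sgraph) :
  max_valency G <= pmd R G.
Proof.
rewrite /pmd; case: ex_minnP => p /asboolP pmdp _.
by apply/bigmax_leqP => x _; exact: valency_le_pmd pmdp.
Qed.

(** The form in which decompositions are built: the edges of colour at least
    [i] are those left when the colours below [i] have been removed, and the
    weight for part [i] is constrained on them only. *)
Lemma has_pmd_of_colouring (R : realType) (G : sgraph) p (c : G -> G -> nat)
    (w : nat -> G -> R) :
  (forall u v, c u v = c v u) ->
  (forall u v, adj u v -> c u v < p) ->
  (forall u v v', adj u v -> adj u v' -> c u v = c u v' -> v = v') ->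
  (forall u v, adj u v -> (0 < w (c u v) u + w (c u v) v)%R) ->
  (forall i u v, adj u v -> i < c u v -> (w i u + w i v < 0)%R) ->
  has_pmd R G p.
Proof.
move=> c_sym c_lt c_inj w_pos w_neg.
pose E (i : 'I_p) := [set [set u; v] | u in G, v in G & adj u v && (c u v == i)].
have memE i u v : ([set u; v] \in E i) = adj u v && (c u v == i).
  apply/imset2P/idP => [[x y _]|uv]; last by exists u v; rewrite ?inE.
  rewrite inE /= => xy /set2_inj[] [-> ->] //.
  by rewrite adj_sym c_sym.
have Eshape i e : e \in E i ->
    exists u v, [/\ e = [set u; v], adj u v & c u v = i].
  case/imset2P=> u v _; rewrite inE => /andP[_ /andP[uv /eqP cuv]] ->.
  by exists u, v.
exists E; split.
- apply/setP => e; apply/bigcupP/idP => [[i _ /Eshape[u [v [-> uv _]]]]|].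
    by rewrite mem_edges.
  case/edgesP=> u [v [uv ->]]; exists (Ordinal (c_lt u v uv)) => //.
  by rewrite memE uv /=.
- move=> i j; apply: contraNT => /pred0Pn[e /andP[/= /Eshape[u [v [-> uv cuv]]]]].
  by rewrite memE uv cuv.
move=> i; split.
- apply/subsetP => e /Eshape[u [v [-> uv cuv]]].
  rewrite inE mem_edges uv andbT; apply/bigcupP => -[j].
  by rewrite memE uv cuv /= => ji /eqP ij; rewrite ij ltnn in ji.
- apply/trivIsetP => A B /Eshape[u [v [-> uv cuv]]] /Eshape[x [y [-> xy cxy]]].
  apply: contraNT => /pred0Pn[z /andP[/=]]; rewrite !in_set2.
  have vu : adj v u by rewrite adj_sym.
  have yx : adj y x by rewrite adj_sym.
  have cvu := c_sym u v; have cyx := c_sym x y.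
  have inj t s s' := @c_inj t s s'.
  case/orP=> /eqP-> /orP[] /eqP e; subst.
  + by rewrite (inj x v y) // cuv cxy.
  + by rewrite (inj y v x) ?[[set y; x]]setUC // cuv -cyx cxy.
  + by rewrite (inj x u y) ?[[set y; x]]setUC // -cvu cuv cxy.
  by rewrite (inj y u x) // -cvu cuv -cyx cxy.
exists (w i) => u v; split; first by rewrite memE => /andP[uv /eqP <-]; exact: w_pos.
rewrite !inE memE mem_edges => /andP[/[swap] /andP[later uv]].
rewrite uv /= => ci; apply: w_neg => //.
rewrite ltn_neqAle eq_sym ci /= leqNgt; apply: contra later => ci'.
by apply/bigcupP; exists (Ordinal (c_lt u v uv)); rewrite // memE uv /=.
Qed.

(** * The subdivision into paths of length seven *)

Section Subdivision.
Variable G : sgraph.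

Definition dart : finType := {p : G * G | adj p.1 p.2}.

Definition source (d : dart) : G := (val d).1.
Definition target (d : dart) : G := (val d).2.

Lemma adj_dart (d : dart) : adj (source d) (target d).
Proof. exact: valP d. Qed.

Lemma adj_opp (d : dart) : adj (target d) (source d).
Proof. by rewrite adj_sym adj_dart. Qed.

Definition opp (d : dart) : dart := Sub (target d, source d) (adj_opp d).

Lemma dart_inj d d' : source d = source d' -> target d = target d' -> d = d'.
Proof.
move=> es et; apply: val_inj.
by rewrite [val d]surjective_pairing [val d']surjective_pairing; congr pair.
Qed.

Lemma oppK : involutive opp.
Proof. by move=> d; exact: dart_inj. Qed.

Lemma opp_neq d : (opp d == d) = false.
Proof.
apply/eqP => e; have := adj_dart d.
by rewrite -[target d]/(source (opp d)) e adj_irrefl.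
Qed.

Definition hvertex : finType := (G + dart * 'I_3)%type.

(** The leg of the dart [d] starts at [source d] and runs through levels
    [0, 1, 2]; the middle edge joins the last levels of the legs of [d] and
    of [opp d]. *)
Definition hadj (u v : hvertex) : bool :=
  match u, v with
  | inl _, inl _ => false
  | inl x, inr (d, k) | inr (d, k), inl x => (source d == x) && (k == 0 :> nat)
  | inr (d, k), inr (d', k') =>
      if d == d' then (k' == k.+1 :> nat) || (k == k'.+1 :> nat)
      else [&& d' == opp d, k == 2 :> nat & k' == 2 :> nat]
  end.

Lemma hadj_sym : symmetric hadj.
Proof.
move=> [x|[d k]] [y|[d' k']] //=; rewrite [d' == d]eq_sym; case: ifP => _.
  by rewrite orbC.
rewrite -(inj_eq (inv_inj oppK)) oppK eq_sym.
by rewrite (andbC (k == 2 :> nat)).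
Qed.

Lemma hadj_irrefl : irreflexive hadj.
Proof. by move=> [x|[d k]] //=; rewrite eqxx orbb ltn_eqF. Qed.

Definition sub7 : sgraph := SGraph hadj_sym hadj_irrefl.

Definition branch (x : G) : sub7 := inl x.

Definition node (d : dart) (k : nat) : sub7 := inr (d, inord k).

Definition dart_path (d : dart) : seq sub7 :=
  [:: node d 0; node d 1; node d 2;
      node (opp d) 2; node (opp d) 1; node (opp d) 0].

Definition inner (x y : G) : seq sub7 :=
  if insub (x, y) is Some d then dart_path d else [::].

Lemma innerE (d : dart) : inner (source d) (target d) = dart_path d.
Proof.
by rewrite /inner -[(source d, target d)]surjective_pairing valK.
Qed.

Variant dart_spec : G -> G -> Prop :=
  DartSpec (d : dart) : dart_spec (source d) (target d).

Lemma adjP x y : adj x y -> dart_spec x y.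
Proof. by move=> xy; exact: (DartSpec (Sub (x, y) xy)). Qed.

Variant node_spec : sub7 -> Prop :=
  | Branch x : node_spec (branch x)
  | Node d k : k < 3 -> node_spec (node d k).

Lemma nodeP (u : sub7) : node_spec u.
Proof.
case: u => [x|[d k]]; first exact: Branch.
by rewrite -[k]inord_val; exact: (Node d (ltn_ord k)).
Qed.

Lemma node_eq d k d' k' :
  k < 3 -> k' < 3 -> (node d k == node d' k') = (d == d') && (k == k').
Proof.
move=> lt_k lt_k'.
apply/eqP/andP => [[-> /(congr1 val)]|[/eqP-> /eqP->]] //.
by rewrite /= !inordK // => ->; rewrite !eqxx.
Qed.

Variant step : sub7 -> sub7 -> Prop :=
  | RootStep d : step (branch (source d)) (node d 0)
  | LegStep d k : k < 2 -> step (node d k) (node d k.+1)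
  | MiddleStep d : step (node d 2) (node (opp d) 2).

Lemma hadj_step (u v : sub7) : adj u v -> step u v \/ step v u.
Proof.
case: (nodeP u) => [x|d k lt_k]; case: (nodeP v) => [y|d' k' lt_k'] //=;
  rewrite !inordK //.
- by case/andP=> /eqP <- /eqP->; left; exact: RootStep.
- by case/andP=> /eqP <- /eqP->; right; exact: RootStep.
case: eqP => [<- /orP[]/eqP e|_ /and3P[/eqP-> /eqP-> /eqP->]].
- by left; rewrite e; apply: LegStep; rewrite -ltnS -e.
- by right; rewrite e; apply: LegStep; rewrite -ltnS -e.
by left; exact: MiddleStep.
Qed.

Lemma mem_dart_path (d d' : dart) k :
  k < 3 -> (node d' k \in dart_path d) = (d' == d) || (d' == opp d).
Proof.
by case: k => [|[|[|//]]] _; rewrite !inE !node_eq // !andbT !andbF ?orbF.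
Qed.

Lemma branch_notin_path d x : branch x \notin dart_path d.
Proof. by rewrite !inE. Qed.

Lemma opp_dart_path d : dart_path (opp d) = rev (dart_path d).
Proof. by rewrite /dart_path oppK. Qed.

Lemma step_infix u v : step u v -> exists d : dart,
  infix [:: u; v] (branch (source d) :: rcons (dart_path d) (branch (target d))).
Proof.
case=> [d|d k|d]; try (move=> lt_k); exists d; apply/infixP.
- by exists [::]; eexists.
- case: k lt_k => [|[|//]] _; first by exists [:: branch (source d)]; eexists.
  by exists [:: branch (source d); node d 0]; eexists.
by exists [:: branch (source d); node d 0; node d 1]; eexists.
Qed.

Lemma subdivision_sub7 : subdivision G sub7.
Proof.
exists branch, inner; split.
- by move=> x y [].
- move=> _ _ /adjP[d]; rewrite innerE /= !eqxx !inordK //=.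
  by rewrite eq_sym opp_neq.
- move=> _ _ /adjP[d]; rewrite innerE /= !inE !node_eq // ?eqxx.
  by rewrite [d == _]eq_sym opp_neq.
- move=> _ _ /adjP[d]; rewrite (innerE (opp d)) innerE; exact: opp_dart_path.
- by move=> _ _ z /adjP[d]; rewrite innerE branch_notin_path.
- move=> _ _ _ _ v /adjP[d] /adjP[d']; rewrite !innerE.
  case: (nodeP v) => [x vd _|e k lt_k vd vd'].
    by case/negP: (branch_notin_path d x).
  rewrite (mem_dart_path d e lt_k) in vd.
  rewrite (mem_dart_path d' e lt_k) in vd'.
  case/orP: vd vd' => /eqP-> /orP[]/eqP.
  + by move->.
  + by move->; rewrite setUC.
  + by move<-; rewrite setUC.
  by move/(inv_inj oppK)->.
- move=> v; case: (nodeP v) => [x|d k lt_k]; first by left; exists x.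
  right; exists (source d), (target d); split; first exact: adj_dart.
  by rewrite innerE mem_dart_path // eqxx.
move=> u v /hadj_step[] /step_infix[d uv].
  by exists (source d), (target d); rewrite innerE; split; first exact: adj_dart.
exists (target d), (source d); split; first exact: adj_opp.
rewrite (innerE (opp d)) opp_dart_path -rev_cons -rev_rcons.
by rewrite -[[:: u; v]]/(rev [:: v; u]) infix_rev.
Qed.

(** * The colouring and the weights *)

(** Distinct for the darts leaving the same vertex; the dart of rank [0] selects
    the edge of the first part at that vertex. *)
Definition rank (d : dart) : nat :=
  index (target d) (enum [set y | adj (source d) y]).

Lemma rank_lt d : rank d < max_valency G.
Proof.
apply: (@leq_trans (valency (source d))); last exact: leq_bigmax.
by rewrite /valency cardE index_mem mem_enum inE adj_dart.
Qed.

Lemma rank_inj d d' : source d = source d' -> rank d = rank d' -> d = d'.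
Proof.
rewrite /rank => es; rewrite -es => er; apply: dart_inj => //.
have mem_target e : target e \in enum [set y | adj (source e) y].
  by rewrite mem_enum inE adj_dart.
by rewrite -(nth_index (target d) (mem_target d)) er nth_index // es.
Qed.

(** The colours met when walking along the leg of [d] from its root, ending
    with the middle edge.  At the root, colour [0] is used once among the legs
    at a given vertex; the next two edges take the colours [1] and [2] in the
    order that avoids a clash with the root edge. *)
Definition leg_colour (d : dart) (k : nat) : nat :=
  match k with
  | 0 => rank d
  | 1 => if rank d == 1 then 2 else 1
  | 2 => if rank d == 1 then 1 else 2
  | _ => 0
  end.

Lemma leg_colour_lt d k : 3 <= max_valency G -> leg_colour d k < max_valency G.
Proof.
move=> G3; have lt3 c : c < 3 -> c < max_valency G by move/leq_trans; apply.
case: k => [|[|[|k]]] /=; first exact: rank_lt; last exact: lt3.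
  by case: ifP => _; exact: lt3.
by case: ifP => _; exact: lt3.
Qed.

Lemma leg_colour_next d k : k < 3 -> leg_colour d k != leg_colour d k.+1.
Proof. by case: k => [|[|[|//]]] _ /=; case: (rank d) => [|[|]]. Qed.

Definition colour (u v : sub7) : nat :=
  match u, v with
  | inl _, inl _ => 0
  | inl _, inr (d, _) | inr (d, _), inl _ => leg_colour d 0
  | inr (d, k), inr (d', k') => leg_colour d (if d == d' then maxn k k' else 3)
  end.

Lemma colour_sym u v : colour u v = colour v u.
Proof.
case: u v => [x|[d k]] [y|[d' k']] //=.
by rewrite eq_sym; case: eqP => // ->; rewrite maxnC.
Qed.

Lemma colour_root d : colour (branch (source d)) (node d 0) = leg_colour d 0.
Proof. by []. Qed.

Lemma colour_leg d k :
  k < 2 -> colour (node d k) (node d k.+1) = leg_colour d k.+1.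
Proof.
move=> lt_k; rewrite /= eqxx !inordK ?(leq_trans lt_k) //.
by rewrite (maxn_idPr _).
Qed.

Lemma colour_middle d : colour (node d 2) (node (opp d) 2) = 0.
Proof. by rewrite /= eq_sym opp_neq. Qed.

Definition down d k : sub7 := if k is k'.+1 then node d k' else branch (source d).
Definition up d k : sub7 := if k < 2 then node d k.+1 else node (opp d) 2.

(** An inner vertex is met by two consecutive edges of its leg, the middle edge
    counting as the last one. *)
Lemma node_neighbour d k v : k < 3 -> adj (node d k) v ->
  v = down d k /\ colour (node d k) v = leg_colour d k \/
  v = up d k /\ colour (node d k) v = leg_colour d k.+1.
Proof.
move=> lt_k; case: (nodeP v) => [y|d' k' lt_k'] /=; rewrite !inordK //.
  by case/andP=> /eqP <- /eqP->; left.
case: eqP => [<- /orP[]/eqP e|_ /and3P[/eqP-> /eqP-> /eqP->]]; last by right.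
  by right; rewrite /up -ltnS -e lt_k' e (maxn_idPr _).
by left; rewrite e (maxn_idPl _).
Qed.

Lemma colour_proper (u v v' : sub7) :
  adj u v -> adj u v' -> colour u v = colour u v' -> v = v'.
Proof.
case: (nodeP u) => [x|d k lt_k].
  case: v v' => [y|[d1 k1]] [z|[d2 k2]] //=.
  case/andP=> /eqP s1 /eqP k10 /andP[/eqP s2 /eqP k20] /rank_inj e.
  rewrite e ?s1 ?s2 //; congr (inr (_, _)); apply: val_inj.
  by rewrite /= k10 k20.
have /eqP next := leg_colour_next d lt_k.
move=> /(node_neighbour lt_k)[] [-> ->] /(node_neighbour lt_k)[] [-> ->] //.
by move/esym.
Qed.

Lemma colour_lt u v :
  3 <= max_valency G -> colour u v < max_valency G.
Proof.
move=> G3; case: u v => [x|[d k]] [y|[d' k']]; try exact: leg_colour_lt.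
exact: leq_trans G3.
Qed.

Section Weights.
Variable R : realType.
Local Open Scope ring_scope.

Definition sign (i : nat) (d : dart) (k : nat) : R :=
  if leg_colour d k == i then 1 else -1.

(** The tree recursion along the leg of [d], counting vertices from the root. *)
Fixpoint leg_weight i d k : R :=
  if k is k'.+1 then sign i d k' - leg_weight i d k' else -2.

Definition weight i (u : sub7) : R :=
  if u is inr (d, k) then leg_weight i d k.+1 else -2.

Lemma weight_node i d k : (k < 3)%N -> weight i (node d k) = leg_weight i d k.+1.
Proof. by move=> lt_k; rewrite [LHS]/= inordK. Qed.

(** Edges [1] and [2] of a leg never have colour [0], so at [i = 0] the weight
    at the end of the leg is [2 + sign 0 d 0]. *)
Lemma weight_middle d : 0 < weight 0 (node d 2).
Proof.
rewrite weight_node //= /sign /=.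
by case: (rank d) => [|[|n]] /=; lra.
Qed.

(** For [i > 0] only leg edges are constrained, so the recursion suffices:
    the middle edges, which close the cycles, have colour [0]. *)
Lemma weight_step i u v : step u v -> (i <= colour u v)%N ->
  if colour u v == i then 0 < weight i u + weight i v
  else weight i u + weight i v < 0.
Proof.
have sgn d k : if leg_colour d k == i then 0 < sign i d k else sign i d k < 0.
  by rewrite /sign; case: eqP => _; lra.
case=> [d|d k lt_k|d].
- rewrite colour_root weight_node //= => _.
  by rewrite addrCA subrr addr0; exact: (sgn d 0%N).
- rewrite colour_leg // !weight_node //= ?(leq_trans lt_k) // => _.
  by rewrite addrC subrK; exact: (sgn d k.+1).
rewrite colour_middle leqn0 => /eqP->; rewrite eqxx.
by rewrite addr_gt0 ?weight_middle.
Qed.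

Lemma weight_adj i (u v : sub7) : adj u v -> (i <= colour u v)%N ->
  if colour u v == i then 0 < weight i u + weight i v
  else weight i u + weight i v < 0.
Proof.
case/hadj_step=> st; first exact: weight_step.
by rewrite colour_sym addrC; exact: weight_step.
Qed.

Lemma has_pmd_sub7 : (3 <= max_valency G)%N -> has_pmd R sub7 (max_valency G).
Proof.
move=> G3; apply: (@has_pmd_of_colouring R sub7 _ colour weight).
- exact: colour_sym.
- by move=> u v _; exact: colour_lt.
- exact: colour_proper.
- by move=> u v uv; have := weight_adj uv (leqnn _); rewrite eqxx.
by move=> i u v uv lt_i; have := weight_adj uv (ltnW lt_i); rewrite gtn_eqF.
Qed.

End Weights.

(** The neighbours of a branch vertex are the first vertices of its legs. *)
Lemma max_valency_sub7 : max_valency G <= max_valency sub7.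
Proof.
apply/bigmax_leqP => x _; apply: leq_trans (leq_bigmax (branch x)).
pose end_from z (v : sub7) := if v is inr (d, _) then target d else z.
apply: leq_trans (leq_imset_card (end_from x) _).
apply/subset_leq_card/subsetP => y; rewrite inE => /adjP[d].
apply/imsetP; exists (node d 0) => //.
by rewrite inE /= eqxx inordK.
Qed.

End Subdivision.

Theorem proposition2p2 (R : realType) (G : sgraph)
    (hconn : connected G) (hdeg : 3 <= max_valency G) :
  exists H : sgraph, subdivision G H /\ pmd R H = max_valency H.
Proof.
exists (sub7 G); split; first exact: subdivision_sub7.
apply/eqP; rewrite eqn_leq max_valency_le_pmd andbT.
apply: leq_trans (max_valency_sub7 G).
rewrite /pmd; case: ex_minnP => p _; apply.
by apply/asboolP; exact: has_pmd_sub7.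
Qed.
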